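(* Let $G$ be a finite abelian group. Then the transiso graph $\Gamma_d(G)$ is complete for each divisor $d$ of $|G|$ if and only if each Sylow subgroup of $G$ is either elementary abelian or cyclic.
   Context: For a finite group $G$ and a subgroup $H\le G$, a normalized right transversal (NRT) of $H$ in $G$ is a subset $S\subseteq G$ with $1\in S$ containing exactly one element of each right coset of $H$ in $G$; $\mathcal{T}(G,H)$ denotes the set of all NRTs of $H$ in $G$. An NRT $S$ carries the induced binary operation $\circ$ defined by $\{x\circ y\}=S\cap Hxy$ for $x,y\in S$, which makes $S$ a right loop with identity $1$. Two NRTs $S,T$ (possibly of different subgroups) are isomorphic, $S\cong T$, if there is a bijection $S\to T$ preserving the induced operations. For a divisor $d$ of $|G|$, the transiso graph $\Gamma_d(G)$ is the simple graph whose vertices are the subgroups of $G$ of order $d$, and in which two distinct vertices $H_1,H_2$ are adjacent if and only if there exist $S_i\in\mathcal{T}(G,H_i)$ $(i=1,2)$ with $S_1\cong S_2$. A graph is complete if any two distinct vertices are adjacent (graphs with at most one vertex are complete). *)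

(* Defs.v *)
From mathcomp Require Import all_boot all_fingroup all_solvable.

Set Implicit Arguments.
Unset Strict Implicit.
Unset Printing Implicit Defensive.

Local Open Scope group_scope.

(* H :* x is the right coset Hx, and rcosets H G the set of all right cosets
   of H in G. *)
Definition nrt (gT : finGroupType) (G H : {set gT}) : {set {set gT}} :=
  [set S : {set gT} | (1 \in S) && is_transversal S (rcosets H G) G].

(* x o y is the unique element of S :&: Hxy; the default value 1 of
   transversal_repr is irrelevant when S is a transversal and x, y \in S. *)
Definition nrt_op (gT : finGroupType) (H S : {set gT}) (x y : gT) : gT :=
  transversal_repr 1 S (H :* (x * y)).

(* (H1, S1) and (H2, S2) stand for transversals S1 of H1 and S2 of H2; the
   induced operation depends on the subgroup as well as on the set. *)
Definition nrt_isog (gT : finGroupType) (H1 S1 H2 S2 : {set gT}) : Prop :=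
  exists f : gT -> gT,
    [/\ {in S1 &, injective f}, f @: S1 = S2
      & {in S1 &, forall x y, f (nrt_op H1 S1 x y) = nrt_op H2 S2 (f x) (f y)}].

Definition transiso_vertices (gT : finGroupType) (G : {set gT}) (d : nat) :
    {set {group gT}} :=
  [set H : {group gT} | (H \subset G) && (#|H| == d)].

Definition transiso_adj (gT : finGroupType) (G : {set gT})
    (H1 H2 : {group gT}) : Prop :=
  H1 <> H2 /\
  exists S1 S2 : {set gT},
    [/\ S1 \in nrt G H1, S2 \in nrt G H2 & nrt_isog H1 S1 H2 S2].

Definition complete_graph (T : finType) (V : {set T}) (adj : T -> T -> Prop) :
    Prop :=
  {in V &, forall x y : T, x <> y -> adj x y}.

Definition transiso_complete (gT : finGroupType) (G : {set gT}) (d : nat) :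
    Prop :=
  complete_graph (transiso_vertices G d) (transiso_adj G).

(* Main.v *)
Require Import Defs.
From mathcomp Require Import all_boot all_fingroup all_solvable.

Local Open Scope group_scope.

(* In an abelian group H is normal and coset H identifies every transversal
   with G / H, so H1 and H2 are adjacent iff G / H1 and G / H2 are isomorphic.
   If the Sylow subgroups are elementary abelian or cyclic, then so are those of
   G / H, and the order of H determines each of them.
   Conversely let P be a Sylow p-subgroup that is not elementary abelian.  Then
   'Phi(P) != 1 is the only subgroup of P of its order, since P / K elementary
   abelian forces 'Phi(P) \subset K; and an abelian p-group having a unique
   subgroup of some order strictly between 1 and its own is cyclic. *)

(** * Transversals of a normal subgroup as copies of the quotient group *)

Lemma coset_transversal_repr {gT : finGroupType} {G H : {group gT}}
    {S : {set gT}} {x : gT} :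
  G \subset 'N(H) -> S \in nrt G H -> x \in G ->
  transversal_repr 1 S (H :* x) \in S /\
  coset H (transversal_repr 1 S (H :* x)) = coset H x.
Proof.
move=> nHG /setIdP[_ trS] Gx.
have HxP : H :* x \in rcosets H G by apply/rcosetsP; exists x.
split; first exact: repr_mem_transversal trS _ _ HxP.
have /rcosetP[h Hh ->] := repr_mem_pblock trS 1 HxP.
by rewrite mkerl ?ker_coset // (subsetP nHG).
Qed.

Lemma nrt_sub {gT : finGroupType} {G H S : {set gT}} :
  S \in nrt G H -> S \subset G.
Proof. by case/setIdP=> _ /transversal_sub. Qed.

Lemma coset_nrt_inj {gT : finGroupType} {G H : {group gT}} {S : {set gT}} :
  G \subset 'N(H) -> S \in nrt G H -> {in S &, injective (coset H)}.
Proof.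
move=> nHG nS x y Sx Sy eq_xy; have /setIdP[_ trS] := nS.
have sSG := subsetP (nrt_sub nS); have sGN := subsetP nHG.
have HxP : H :* x \in rcosets H G by apply/rcosetsP; exists x; rewrite ?sSG.
have Hxy : y \in H :* x.
  by apply/rcoset_kercosetP; rewrite ?sGN ?sSG.
have defI := setI_transversal_pblock trS 1 HxP.
have /set1P-> : x \in [set transversal_repr 1 S (H :* x)].
  by rewrite -defI inE Sx rcoset_refl.
by apply/esym/set1P; rewrite -defI inE Sy.
Qed.

(** Together with [coset_nrt_inj], this makes [coset H] an embedding of the right loop [S] into the
    group [G / H]. *)
Lemma coset_nrt_op {gT : finGroupType} {G H : {group gT}} {S : {set gT}} :
  G \subset 'N(H) -> S \in nrt G H ->
  {in S &, forall x y, nrt_op H S x y \in S /\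
     coset H (nrt_op H S x y) = coset H x * coset H y}.
Proof.
move=> nHG nS x y Sx Sy; have sSG := subsetP (nrt_sub nS).
have sGN := subsetP nHG.
have [-> ->] := coset_transversal_repr nHG nS (groupM (sSG x Sx) (sSG y Sy)).
by rewrite morphM ?sGN ?sSG.
Qed.

Lemma mem_repr_quotient {gT : finGroupType} {G H : {group gT}}
    {u : coset_of H} :
  H \subset G -> u \in G / H -> repr u \in G.
Proof.
move=> sHG /morphimP[x Nx Gx ->]; have := mem_repr_coset (coset H x).
by rewrite val_coset // => /rcosetP[h Hh ->]; rewrite groupM // (subsetP sHG).
Qed.

Lemma nrt_isog_quotient (gT : finGroupType) (G H1 H2 : {group gT})
    (S1 S2 : {set gT}) :
  H1 <| G -> H2 <| G -> S1 \in nrt G H1 -> S2 \in nrt G H2 ->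
  nrt_isog H1 S1 H2 S2 -> G / H1 \isog G / H2.
Proof.
case/andP=> sH1 nH1 /andP[_ nH2] nS1 nS2 [f [injf fS fM]].
(* [g] inverts [coset H1] on [S1]; the isomorphism [psi] below is [f] read through the
   identifications of [S1] and [S2] with the quotients. *)
pose g (u : coset_of H1) := transversal_repr 1 S1 (H1 :* repr u).
have gP u : u \in G / H1 -> g u \in S1 /\ coset H1 (g u) = u.
  move=> Gu; rewrite -[RHS]coset_reprK.
  exact: coset_transversal_repr nH1 nS1 (mem_repr_quotient sH1 Gu).
have fS2 x : x \in S1 -> f x \in S2 by move=> Sx; rewrite -fS imset_f.
have sS2G := subsetP (nrt_sub nS2).
pose psi u := coset H2 (f (g u)).
apply: (@misom_isog _ _ _ _ psi); apply/misomP.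
have psiM : morphic (G / H1) psi.
  apply/morphicP=> u v Gu Gv; have [Su cu] := gP u Gu; have [Sv cv] := gP v Gv.
  have [Suv cuv] := gP _ (groupM Gu Gv).
  have [So co] := coset_nrt_op nH1 nS1 _ _ Su Sv.
  (* [g (u * v)] and the loop product of [g u] and [g v] are elements of [S1] in the same coset,
     hence equal. *)
  have -> : psi (u * v) = coset H2 (f (nrt_op H1 S1 (g u) (g v))).
    congr (coset _ (f _)); apply: (coset_nrt_inj nH1 nS1) => //.
    by rewrite cuv co cu cv.
  by rewrite fM //; case: (coset_nrt_op nH2 nS2 _ _ (fS2 _ Su) (fS2 _ Sv)).
exists psiM; apply/isomP; split.
  apply/injmP=> u v Gu Gv; rewrite /= !morphmE => eq_uv.
  have [Su cu] := gP u Gu; have [Sv cv] := gP v Gv.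
  rewrite -cu -cv; congr coset; apply: injf => //.
  by apply: (coset_nrt_inj nH2 nS2); rewrite ?fS2.
rewrite morphimEdom; apply/setP=> w; apply/imsetP/idP=> [[u Gu ->] | ].
  by rewrite /= morphmE mem_quotient // sS2G ?fS2 //; case: (gP u Gu).
case/morphimP=> y Ny Gy /= ->.
(* The coset of [y] is represented by an element of [S2], that is by some [f x], so its preimage is
   the coset of [x]. *)
have [Sr <-] := coset_transversal_repr nH2 nS2 Gy; move: Sr.
rewrite -fS => /imsetP[x Sx ->].
have Gx : coset H1 x \in G / H1.
  by rewrite mem_quotient ?(subsetP (nrt_sub nS1)).
exists (coset H1 x) => //; rewrite /= morphmE /psi.
have [Sg cg] := gP _ Gx; congr (coset _ (f _)).
by apply: (coset_nrt_inj nH1 nS1).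
Qed.

Lemma repr_nrt (gT : finGroupType) (G H : {group gT}) :
  H <| G -> [set repr (u : {set gT}) | u : coset_of H in G / H] \in nrt G H.
Proof.
case/andP=> sHG nHG; have sGN := subsetP nHG.
rewrite inE; apply/andP; split.
  (* [repr] returns 1 on any set containing 1, so the trivial coset contributes 1. *)
  by apply/imsetP; exists 1; rewrite ?group1 // repr_group.
apply/and3P; split; first exact: rcosets_partition.
  by apply/subsetP=> _ /imsetP[u Gu ->]; apply: mem_repr_quotient.
apply/forall_inP=> _ /rcosetsP[x Gx ->]; apply/cards1P.
have Gu : coset H x \in G / H by rewrite mem_quotient.
exists (repr (coset H x)); apply/setP=> y; rewrite 2!inE.
apply/andP/eqP=> [[/imsetP[u Gu' ->]] | ->]; last first.
  split; first by apply/imsetP; exists (coset H x).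
  by rewrite -val_coset ?sGN // mem_repr_coset.
by rewrite -val_coset ?sGN // => /coset_mem; rewrite coset_reprK => ->.
Qed.

Lemma isog_quotient_nrt (gT : finGroupType) (G H1 H2 : {group gT}) :
  H1 <| G -> H2 <| G -> G / H1 \isog G / H2 ->
  exists S1 S2 : {set gT},
    [/\ S1 \in nrt G H1, S2 \in nrt G H2 & nrt_isog H1 S1 H2 S2].
Proof.
move=> nsH1 nsH2 /isogP[phi injphi im_phi].
have nS1 := repr_nrt _ _ _ nsH1; have nS2 := repr_nrt _ _ _ nsH2.
do 2!eexists; split; [exact: nS1 | exact: nS2 |].
have [_ nH1] := andP nsH1; have [_ nH2] := andP nsH2.
set S1 := imset _ _ in nS1 *; set S2 := imset _ _ in nS2 *.
(* [f] is [phi] lifted to the canonical coset representatives. *)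
pose f x := repr (phi (coset H1 x) : {set gT}).
have S1G x : x \in S1 -> coset H1 x \in G / H1.
  by case/imsetP=> u Gu ->; rewrite coset_reprK.
have cf x : coset H2 (f x) = phi (coset H1 x) by apply: coset_reprK.
have fS x : x \in S1 -> f x \in S2.
  move=> Sx; apply/imsetP; exists (phi (coset H1 x)) => //.
  by rewrite -im_phi mem_morphim ?S1G.
exists f; split.
- move=> x y Sx Sy /(congr1 (coset H2)); rewrite !cf => eq_xy.
  by apply: (coset_nrt_inj nH1 nS1) => //; apply: (injmP injphi); rewrite ?S1G.
- apply/setP=> y; apply/imsetP/idP=> [[x Sx ->] | ]; first exact: fS.
  case/imsetP=> v; rewrite -im_phi => /morphimP[u _ Gu ->] ->.
  exists (repr u); last by rewrite /f coset_reprK.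
  by apply/imsetP; exists u.
move=> x y Sx Sy; have [So co] := coset_nrt_op nH1 nS1 _ _ Sx Sy.
have [So2 co2] := coset_nrt_op nH2 nS2 _ _ (fS _ Sx) (fS _ Sy).
apply: (coset_nrt_inj nH2 nS2); rewrite ?fS //.
by rewrite co2 !cf co morphM ?S1G.
Qed.

(** * Comparing quotients one prime at a time *)

Lemma nilpotent_isog_pcore (aT rT : finGroupType) (A : {group aT})
    (B : {group rT}) :
  nilpotent A -> nilpotent B -> #|A| = #|B| ->
  (forall p, prime p -> 'O_p(A) \isog 'O_p(B)) -> A \isog B.
Proof.
have [n] := ubnP #|A|; elim: n => // n IHn in A B *.
rewrite ltnS => leAn nilA nilB oAB isoO.
have [A1 | ntA] := eqVneq #|A| 1%N.
  by rewrite (card1_trivg A1) (card1_trivg (etrans (esym oAB) A1)) isog_sym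
             trivial_isog.
have p_pr : prime (pdiv #|A|).
  by rewrite pdiv_prime // ltn_neqAle eq_sym ntA cardG_gt0.
set p := pdiv _ in p_pr.
(* Both groups split as the direct product of their [p]-core and [p^']-core. The latter is smaller
   than [A] because [p] divides its order, so induction applies. *)
have defA := nilpotent_pcoreC p nilA; have defB := nilpotent_pcoreC p nilB.
have oA := dprod_card defA; have oB := dprod_card defB.
have isop := isoO p p_pr; have oO := card_isog isop.
apply: (isog_dprod defA defB isop); apply: IHn.
- apply: leq_trans leAn; rewrite -[ltnRHS]oA ltn_Pmull ?cardG_gt0 //.
  rewrite (card_Hall (nilpotent_pcore_Hall p nilA)).
  by rewrite p_part_gt1 pi_pdiv ltn_neqAle eq_sym ntA cardG_gt0.
- exact: nilpotentS (pcore_sub _ _) nilA.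
- exact: nilpotentS (pcore_sub _ _) nilB.
- apply/eqP; rewrite -(eqn_pmul2l (cardG_gt0 'O_p(A))) oA.
  by rewrite oO oB oAB.
move=> q q_pr; rewrite /=; have [-> | neq_qp] := eqVneq q p.
  have trivO (xT : finGroupType) (C : {group xT}) : 'O_p('O_p^'(C)) = 1.
    apply/card1_trivg/(@pnat_1 p); first exact: pcore_pgroup.
    exact: pgroupS (pcore_sub _ _) (pcore_pgroup _ _).
  by rewrite !trivO trivial_isog.
(* For [q] other than [p], the [q]-core of the [p^']-core is the [q]-core of the whole group. *)
have piq : [predI (q : nat_pred) & p^'] =i (q : nat_pred).
  by move=> r; rewrite !inE; case: eqP => // ->.
by rewrite -!pcoreI !(eq_pcore _ piq) isoO.
Qed.

Lemma pcore_quotient_Sylow {gT : finGroupType} {G H P : {group gT}} {p : nat} :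
  abelian G -> H \subset G -> p.-Sylow(G) P -> 'O_p(G / H) = P / H.
Proof.
move=> abG sHG sylP; apply/esym/nilpotent_Hall_pcore.
  exact/abelian_nil/quotient_abelian.
have nHP := subset_trans (pHall_sub sylP) (sub_abelian_norm abG sHG).
exact: quotient_pHall nHP sylP.
Qed.

Lemma abelian_isog_quotient (gT : finGroupType) (G H1 H2 : {group gT}) :
  abelian G -> H1 \subset G -> H2 \subset G -> #|H1| = #|H2| ->
  (forall (p : nat) (P : {group gT}),
     prime p -> p.-Sylow(G) P -> p.-abelem P \/ cyclic P) ->
  G / H1 \isog G / H2.
Proof.
move=> abG sH1 sH2 oH sylG.
have nH (H : {group gT}) : H \subset G -> G \subset 'N(H).
  exact: sub_abelian_norm.
have abQ (H : {group gT}) : nilpotent (G / H).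
  exact/abelian_nil/quotient_abelian.
have oQ : #|G / H1| = #|G / H2|.
  by rewrite !card_quotient ?nH // -!divgS // oH.
apply: nilpotent_isog_pcore => // p p_pr.
have oO : #|'O_p(G / H2)| = #|'O_p(G / H1)|.
  by rewrite !(card_Hall (nilpotent_pcore_Hall p (abQ _))) oQ.
have [P sylP] := Sylow_exists p G; move: oO.
rewrite !(pcore_quotient_Sylow abG _ sylP) // => oO.
case: (sylG p P p_pr sylP) => [abelP | cycP].
  by rewrite (isog_abelem_card _ (quotient_abelem _ abelP)) quotient_abelem ?oO /=.
by rewrite isog_cyclic_card ?quotient_cyclic ?oO /=.
Qed.

(** * Abelian p-groups with a unique subgroup of some order *)

Lemma unique_order_cyclic {gT : finGroupType} {P H : {group gT}} {p : nat} :
  prime p -> p.-group P -> abelian P -> H \proper P -> H :!=: 1 ->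
  (forall K : {group gT}, K \subset P -> #|K| = #|H| -> K :=: H) -> cyclic P.
Proof.
move=> p_pr pP abP /properP[sHP [x Px notHx]] ntH uniqH.
have pH := pgroupS sHP pP; have [n oH] := p_natP pH.
have n_gt0 : 0 < n by case: n oH ntH => // /card1_trivg ->; rewrite eqxx.
(* Compare [H] with [<[x]>]. If [<[x]>] is at least as large, it has a subgroup of order [#|H|],
   which must be [H]. *)
have cycH : cyclic H.
  have sxP : <[x]> \subset P by rewrite cycle_subG.
  have px := pgroupS sxP pP; have [m ox] := p_natP px.
  have [le_nm | /ltnW le_mn] := leqP n m.
    have [|Q [sQx _ oQ]] := normal_pgroup px (normal_refl _) (_ : n <= _).
      by rewrite ox pfactorK.
    by rewrite -(uniqH Q) ?(cyclicS sQx) ?cycle_cyclic ?oQ // (subset_trans sQx).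
  (* Otherwise the preimage of a subgroup of order [p ^ (n - m)] of [P / <[x]>] has order [#|H|] and
     contains [x]; it must be [H], against the choice of [x]. *)
  have nsxP : <[x]> <| P by rewrite -sub_abelian_normal.
  have oPx : #|P / <[x]>| = (#|P| %/ p ^ m)%N.
    by rewrite card_quotient ?normal_norm // -divgS // ox.
  have [k oP] := p_natP pP; have le_nk : n <= k.
    by rewrite -(leq_exp2l _ _ (prime_gt1 p_pr)) -oH -oP subset_leq_card.
  have le_r : n - m <= logn p #|P / <[x]>|.
    by rewrite oPx oP -expnB ?prime_gt0 ?(leq_trans le_mn le_nk) // pfactorK
               ?leq_sub2r.
  have [Q [sQP _ oQ]] :=
    normal_pgroup (quotient_pgroup <[x]> pP) (normal_refl _) le_r.
  case/negP: notHx; rewrite -cycle_subG -(uniqH (coset <[x]> @*^-1 Q)%G).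
  - exact: sub_cosetpre.
  - by rewrite -(quotientGK nsxP) morphpreS.
  by rewrite card_cosetpre oQ ox -expnD subnKC // oH.
(* If y of order p were not in H, the product of <y> with a subgroup of index p
   in H would be a subgroup of order #|H| other than H. *)
have sOH : 'Ohm_1(P) \subset H.
  rewrite (OhmE 1 pP) gen_subG; apply/subsetP=> y; rewrite !inE => /andP[Py yp].
  apply/negPn/negP=> notHy.
  have oy : #[y] = p.
    by apply: nt_prime_order => //; [apply/eqP | apply: contraNneq notHy => ->].
  have [|Q [sQH _ oQ]] := normal_pgroup pH (normal_refl _) (_ : n.-1 <= _).
    by rewrite oH pfactorK ?leq_pred.
  have tiQy : Q :&: <[y]> = 1.
    rewrite setIC prime_TIg -?orderE ?oy // cycle_subG.
    by apply: contra notHy; apply: subsetP.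
  have cQy : <[y]> \subset 'C(Q).
    rewrite (sub_abelian_cent2 abP) ?cycle_subG //; exact: subset_trans sQH sHP.
  have oQy : #|Q <*> <[y]>| = #|H|.
    by rewrite cent_joinEr // TI_cardMg // -orderE oy oQ oH -expnSr prednK.
  have defH : Q <*> <[y]> = H.
    by apply: uniqH oQy; rewrite join_subG cycle_subG Py (subset_trans sQH).
  by case/negP: notHy; rewrite -defH -cycle_subG joing_subr.
(* The rank of [P] is that of ['Ohm_1(P)], hence at most the rank of the cyclic group [H]. *)
rewrite abelian_rank1_cyclic // (rank_pgroup pP) -p_rank_Ohm1.
apply: leq_trans (p_rankS p sOH) _; rewrite -(rank_pgroup pH).
by rewrite -abelian_rank1_cyclic ?cyclic_abelian.
Qed.

Theorem proposition2p6 (gT : finGroupType) (G : {group gT})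
    (abelG : abelian G) :
  (forall d : nat, d %| #|G| -> transiso_complete G d) <->
  (forall (p : nat) (P : {group gT}),
     prime p -> p.-Sylow(G) P -> p.-abelem P \/ cyclic P).
Proof.
split=> [complG p P p_pr sylP | sylG d _ H1 H2]; last first.
  rewrite !inE => /andP[sH1 /eqP oH1] /andP[sH2 /eqP oH2] neqH; split=> //.
  apply: isog_quotient_nrt; rewrite -?sub_abelian_normal //.
  by apply: abelian_isog_quotient; rewrite ?oH1.
have sPG := pHall_sub sylP; have pP := pHall_pgroup sylP.
have abP := abelianS sPG abelG.
have [abelP | nabelP] := boolP (p.-abelem P); [by left | right].
have ntPhi : 'Phi(P) != 1 by rewrite (trivg_Phi pP).
(* [P] is nontrivial, since the trivial group is elementary abelian. *)
have prPhi : 'Phi(P) \proper P.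
  by apply: Phi_proper; apply: contraNneq nabelP => ->; apply: abelem1.
apply: (unique_order_cyclic p_pr pP abP prPhi ntPhi) => K sKP oK.
(* Adjacency is available only for distinct vertices. *)
have [-> // | neqK] := eqVneq K 'Phi(P)%G.
have sPhiG := subset_trans (Phi_sub P) sPG; have sKG := subset_trans sKP sPG.
have nsG (H : {group gT}) : H \subset G -> H <| G.
  by rewrite (sub_abelian_normal H abelG).
have vPhi : 'Phi(P)%G \in transiso_vertices G #|'Phi(P)|.
  by rewrite inE sPhiG eqxx.
have vK : K \in transiso_vertices G #|'Phi(P)|.
  by rewrite inE sKG oK eqxx.
have neqPhiK : 'Phi(P)%G <> K by apply/eqP; rewrite eq_sym.
have [_ [S1 [S2 [nS1 nS2 isoS]]]] :=
  complG _ (cardSg sPhiG) _ _ vPhi vK neqPhiK.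
have isoQ := nrt_isog_quotient _ _ _ _ _ _ (nsG _ sPhiG) (nsG _ sKG) nS1 nS2 isoS.
(* Passing to [p]-cores turns the isomorphism of quotients of [G] into one between [P / 'Phi(P)] and
   [P / K]. *)
have := isog_pcore p isoQ.
rewrite !(pcore_quotient_Sylow abelG _ sylP) // => isoP.
have abelPK : p.-abelem (P / K).
  by rewrite -(isog_abelem isoP) Phi_quotient_abelem.
apply/esym/eqP; rewrite eqEcard oK leqnn andbT.
exact: Phi_min pP (subset_trans sPG (normal_norm (nsG _ sKG))) abelPK.
Qed.
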